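(* Let $\lambda\in\mathbb{R}^p$, $s\in\mathbb{R}^L$, $V\in\mathbb{R}^{L\times p}$, $v\in\mathbb{R}^L$. Suppose there is a factorization $$M:=\begin{pmatrix}\Lambda[\lambda,\lambda^\top]&\Lambda[\lambda,s^\top]&\lambda\\ \Lambda[s,\lambda^\top]&\Lambda[s,s^\top]&s\\ \lambda^\top&s^\top&1\end{pmatrix}=\sum_{k=1}^K\begin{pmatrix}\lambda^{(k)}\\ s^{(k)}\\ \xi^{(k)}\end{pmatrix}\begin{pmatrix}\lambda^{(k)}\\ s^{(k)}\\ \xi^{(k)}\end{pmatrix}^\top$$ with $\lambda^{(k)}\in\mathbb{R}^p$, $s^{(k)}\in\mathbb{R}^L$, $\xi^{(k)}\in\mathbb{R}$, and that for all $i\in\{1,\dots,L\}$, $(\lambda,\Lambda)$ satisfy $$V_{i,*}\lambda+s_i=v_i,$$ $$\langle V_{i,*}^\top V_{i,*},\Lambda[\lambda,\lambda^\top]\rangle+2V_{i,*}\Lambda[\lambda,s_i]+\Lambda[s_i,s_i]=v_i^2.$$ Then we must have, for all $i\in\{1,\dots,L\}$: 1. If $M\in\mathcal{C}^*$, then each factor individually satisfies the inequalities: $V_{i,*}\lambda^{(k)}\le\xi^{(k)}v_i$ for all $k=1,\dots,K$. 2. If $M\in S^+$ and $s\ge 0$, then the weighted sum of factors satisfies the inequalities: $V_{i,*}\lambda=\sum_k\xi^{(k)}V_{i,*}\lambda^{(k)}\le v_i$.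
   Context: $\Lambda\in\mathbb{R}^{(p+L)\times(p+L)}$ is a symmetric matrix whose rows and columns are indexed by the coordinates of the concatenated vector $(\lambda,s)$. Symbolic indexing refers to its blocks and entries: $\Lambda[\lambda,\lambda^\top]\in\mathbb{R}^{p\times p}$, $\Lambda[\lambda,s^\top]\in\mathbb{R}^{p\times L}$, $\Lambda[s,\lambda^\top]=\Lambda[\lambda,s^\top]^\top$, $\Lambda[s,s^\top]\in\mathbb{R}^{L\times L}$; $\Lambda[\lambda,s_i]\in\mathbb{R}^p$ is the $i$-th column of $\Lambda[\lambda,s^\top]$ and $\Lambda[s_i,s_i]$ is the $(i,i)$ entry of $\Lambda[s,s^\top]$. $V_{i,*}$ is the $i$-th row of $V$; $\langle X,Y\rangle=\mathrm{Tr}(X^\top Y)$. $S^+$ is the set of (symmetric) positive semidefinite matrices. $\mathcal{C}^*$ is the cone of completely positive matrices: matrices of the form $\sum_k x^{(k)}(x^{(k)})^\top$ (finite sum) with all $x^{(k)}$ entrywise non-negative real vectors. Inequalities between vectors are entrywise.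
   Formalization: In part 1 the given factors (λ^(k), s^(k), ξ^(k)) are additionally assumed entrywise non-negative, i.e. they witness M ∈ C*; with arbitrary real factors the claim fails, since negating a factor leaves M unchanged. *)

(* Defs.v *)
From mathcomp Require Import all_boot all_order all_algebra.
From mathcomp Require Import reals.

Set Implicit Arguments.
Unset Strict Implicit.
Unset Printing Implicit Defensive.

Import Order.TTheory GRing.Theory Num.Theory.
Local Open Scope ring_scope.

Definition frob {R : realType} {m n : nat} (X Y : 'M[R]_(m, n)) : R :=
  \tr (X^T *m Y).

Definition psd {R : realType} {n : nat} (A : 'M[R]_n) : Prop :=
  A^T = A /\ forall x : 'cV[R]_n, 0 <= (x^T *m A *m x) 0 0.

Definition completely_positive {R : realType} {n : nat} (A : 'M[R]_n) : Prop :=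
  exists (K : nat) (x : 'I_K -> 'cV[R]_n),
    (forall k, x k \is a mxOver Num.nneg) /\ A = \sum_(k < K) x k *m (x k)^T.

Definition stack {R : realType} {p L : nat}
    (lam : 'cV[R]_p) (s : 'cV[R]_L) (xi : R) : 'cV[R]_(p + L + 1) :=
  col_mx (col_mx lam s) xi%:M.

(* Rows and columns of Lam follow the coordinates of (lam, s), so
   Lam[lam, lam^T] = ulsubmx Lam, Lam[lam, s^T] = ursubmx Lam,
   Lam[s, lam^T] = dlsubmx Lam and Lam[s, s^T] = drsubmx Lam. *)
Definition moment_mx {R : realType} {p L : nat} (lam : 'cV[R]_p)
    (s : 'cV[R]_L) (Lam : 'M[R]_(p + L)) : 'M[R]_(p + L + 1) :=
  block_mx Lam (col_mx lam s) (col_mx lam s)^T 1%:M.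

(* Main.v *)
Require Import Defs.
From mathcomp Require Import all_boot all_order all_algebra.
From mathcomp Require Import reals ring lra.

Set Implicit Arguments.
Unset Strict Implicit.
Unset Printing Implicit Defensive.

Import Order.TTheory GRing.Theory Num.Theory.
Local Open Scope ring_scope.

(** The affine constraint [V_i x + s_i = v_i xi] is encoded by the vector
    [w = (V_i, e_i, - v_i)], whose inner product with a stacked vector
    [(x, s, xi)] is the residual of that constraint.  The hypotheses on [Lam]
    and on [(lam, s)] force the quadratic form of the moment matrix to vanish at
    [w]: by [moment_form] it equals
    [v_i^2 - 2 v_i v_i + v_i^2 = 0].  As the moment matrix is a sum of rank-one
    matrices, its form at [w] is also the sum of the squared residuals of the
    factors, so each residual is zero ([gram_form_eq0]): every factor satisfies
    the constraint, homogenized by its own [xi].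

    If the factors are nonnegative, dropping the slack [s_i] turns each of these
    equations into the inequality of the first claim.  For the second claim,
    the last column of the factorization reads [lam] as the [xi]-weighted
    sum of the [lamk] ([lam_weighted_sum]), and the constraint on [(lam, s)]
    itself, with [s_i] nonnegative, gives the bound. *)

(** A Gram form vanishes only where all its linear forms do, since its value
    is the sum of their squares. *)
Lemma gram_form_eq0 (R : realDomainType) (n K : nat) (f : 'I_K -> 'cV[R]_n)
    (w : 'cV[R]_n) :
  (w^T *m (\sum_(k < K) f k *m (f k)^T) *m w) 0 0 = 0 ->
  forall k, (w^T *m f k) 0 0 = 0.
Proof.
have -> : (w^T *m (\sum_(k < K) f k *m (f k)^T) *m w) 0 0 =
          \sum_(k < K) (w^T *m f k) 0 0 ^+ 2.
  rewrite mulmx_sumr mulmx_suml summxE; apply: eq_bigr => k _.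
  rewrite mulmxA -mulmxA -[(f k)^T *m w]trmxK trmx_mul trmxK.
  by rewrite mxE big_ord1 [X in _ * X]mxE expr2 !ord1.
move=> sum0 k; apply/eqP; rewrite -sqrf_eq0; apply/eqP.
by apply: (psumr_eq0P _ sum0) => // j _; exact: sqr_ge0.
Qed.

Lemma frob_outer (R : realType) (p : nat) (a : 'rV[R]_p) (A : 'M[R]_p) :
  frob (a^T *m a) A = (a *m A *m a^T) 0 0.
Proof.
by rewrite /frob trmx_mul trmxK -(mulmxA a^T) mxtrace_mulC trace_mx11.
Qed.

Lemma stack_dot (R : realType) (p L : nat) (a : 'rV[R]_p) (i : 'I_L) (c : R)
    (x : 'cV[R]_p) (y : 'cV[R]_L) (xi : R) :
  ((stack a^T (delta_mx i 0) c)^T *m stack x y xi) 0 0 =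
  (a *m x) 0 0 + y i 0 + c * xi.
Proof.
rewrite /stack !tr_col_mx !mul_row_col trmxK trmx_delta -rowE tr_scalar_mx.
by rewrite -scalar_mxM !mxE eqxx mulr1n.
Qed.

(** The two off-diagonal blocks of [Lam] merge into one cross term by symmetry,
    and so do the border row and column of the moment matrix. *)
Lemma moment_form (R : realType) (p L : nat) (lam : 'cV[R]_p) (s : 'cV[R]_L)
    (Lam : 'M[R]_(p + L)) (a : 'rV[R]_p) (i : 'I_L) (c : R) :
  Lam^T = Lam ->
  let w := stack a^T (delta_mx i 0) c in
  (w^T *m moment_mx lam s Lam *m w) 0 0 =
  frob (a^T *m a) (ulsubmx Lam) + 2 * (a *m col i (ursubmx Lam)) 0 0
  + drsubmx Lam i i + 2 * c * ((a *m lam) 0 0 + s i 0) + c ^+ 2.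
Proof.
move=> Lam_sym w; rewrite frob_outer.
have dlE : dlsubmx Lam = (ursubmx Lam)^T by rewrite trmx_ursub Lam_sym.
set e : 'cV[R]_L := delta_mx i 0.
have eT (n : nat) (B : 'M[R]_(L, n)) : e^T *m B = row i B.
  by rewrite trmx_delta -rowE.
have cross : (row i (dlsubmx Lam) *m a^T) 0 0 = (a *m col i (ursubmx Lam)) 0 0.
  by rewrite dlE -tr_col -trmx_mul mxE.
have border : ((col_mx lam s)^T *m col_mx a^T e) 0 0 = (a *m lam) 0 0 + s i 0.
  rewrite -[_ *m _]trmxK trmx_mul trmxK tr_col_mx mul_row_col trmxK eT.
  by rewrite !mxE.
have scale00 (B : 'M[R]_1) : (c *: B) 0 0 = c * B 0 0 by rewrite mxE.
have inner : ((col_mx a^T e)^T *m Lam *m col_mx a^T e) 0 0 =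
    (a *m ulsubmx Lam *m a^T) 0 0 + 2 * (a *m col i (ursubmx Lam)) 0 0
    + drsubmx Lam i i.
  rewrite -{1}[Lam]submxK tr_col_mx trmxK mul_row_block mul_row_col.
  rewrite !mulmxDl !eT -[a *m ursubmx Lam *m e]mulmxA -!colE.
  rewrite [LHS]mxE [X in X + _]mxE [X in _ + X]mxE cross.
  by rewrite [col i (row _ _) 0 0]mxE [row _ _ 0 i]mxE; ring.
rewrite /w /stack tr_col_mx mul_row_block mul_row_col !mulmxDl tr_scalar_mx.
rewrite mulmx1 mul_scalar_mx -scalemxAl -scalar_mxM.
rewrite -[((col_mx a^T e)^T *m col_mx lam s)]trmxK trmx_mul trmxK.
rewrite mul_mx_scalar [LHS]mxE [X in X + _]mxE inner.
rewrite -/e [X in _ + X]mxE !scale00 [_^T 0 0]mxE border.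
rewrite [(c * c)%:M 0 0]mxE eqxx mulr1n.
by ring.
Qed.

(** Read off from the top right block of the factorization. *)
Lemma lam_weighted_sum (R : realType) (p L K : nat) (lam : 'cV[R]_p) (s : 'cV[R]_L)
    (Lam : 'M[R]_(p + L))
    (lamk : 'I_K -> 'cV[R]_p) (sk : 'I_K -> 'cV[R]_L) (xik : 'I_K -> R) :
  moment_mx lam s Lam =
    \sum_(k < K) stack (lamk k) (sk k) (xik k)
                 *m (stack (lamk k) (sk k) (xik k))^T ->
  lam = \sum_(k < K) xik k *: lamk k.
Proof.
move=> fact; apply/colP => j.
have /matrixP/(_ (lshift 1 (lshift L j)) (rshift (p + L) 0)) := fact.
rewrite block_mxEur col_mxEu => ->; rewrite !summxE; apply: eq_bigr => k _.
rewrite mxE big_ord1 [_^T _ _]mxE /stack !col_mxEu col_mxEd !mxE eqxx mulr1n.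
by rewrite mulrC.
Qed.

(* In the first claim, M being completely positive is understood with the given
   factorization as witness, hence the sign condition on the factors: M alone
   does not determine the factors, e.g. each of them may be negated. *)
Theorem corollary4p2p1 (R : realType) (p L K : nat)
    (lam : 'cV[R]_p) (s : 'cV[R]_L) (V : 'M[R]_(L, p)) (v : 'cV[R]_L)
    (Lam : 'M[R]_(p + L))
    (lamk : 'I_K -> 'cV[R]_p) (sk : 'I_K -> 'cV[R]_L) (xik : 'I_K -> R)
    (Lam_sym : Lam^T = Lam)
    (M_fact : moment_mx lam s Lam =
      \sum_(k < K) stack (lamk k) (sk k) (xik k)
                   *m (stack (lamk k) (sk k) (xik k))^T)
    (lin_eq : forall i : 'I_L, (row i V *m lam) 0 0 + s i 0 = v i 0)
    (quad_eq : forall i : 'I_L,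
      frob ((row i V)^T *m row i V) (ulsubmx Lam)
      + 2 * (row i V *m col i (ursubmx Lam)) 0 0
      + drsubmx Lam i i = v i 0 ^+ 2) :
  forall i : 'I_L,
    (completely_positive (moment_mx lam s Lam) ->
     (forall k : 'I_K, stack (lamk k) (sk k) (xik k) \is a mxOver Num.nneg) ->
     forall k : 'I_K, (row i V *m lamk k) 0 0 <= xik k * v i 0)
    /\
    (psd (moment_mx lam s Lam) ->
     (forall j : 'I_L, 0 <= s j 0) ->
     (row i V *m lam) 0 0 = \sum_(k < K) xik k * (row i V *m lamk k) 0 0
     /\ \sum_(k < K) xik k * (row i V *m lamk k) 0 0 <= v i 0).
Proof.
have residual0 i k :
    (row i V *m lamk k) 0 0 + sk k i 0 - v i 0 * xik k = 0.
  have := @gram_form_eq0 _ _ _ (fun k => stack (lamk k) (sk k) (xik k))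
    (stack (row i V)^T (delta_mx i 0) (- v i 0)).
  rewrite -M_fact moment_form // quad_eq lin_eq => /(_ _ k).
  by rewrite stack_dot mulNr; apply; ring.
move=> i; split=> [_ factor_ge0 k | _ s_ge0].
- have sk_ge0 : 0 <= sk k i 0.
    (* The [i]-th slack sits at position [p + i] of the stacked vector. *)
    have /mxOverP/(_ (lshift 1 (rshift p i)) 0) := factor_ge0 k.
    by rewrite /stack col_mxEu col_mxEd.
  by have := residual0 i k; lra.
- have <- : (row i V *m lam) 0 0 =
            \sum_(k < K) xik k * (row i V *m lamk k) 0 0.
    rewrite (lam_weighted_sum M_fact) mulmx_sumr summxE; apply: eq_bigr => k _.
    by rewrite -scalemxAr mxE.
  by split=> //; have := lin_eq i; have := s_ge0 i; lra.
Qed.
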